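(* (i) For $n\ge 1$, the number $|\mathrm{Cay}_X[n]|$ of Cayley permutations of $[n]$ whose functional digraph is a tree equals the number of all Cayley permutations of $[n-1]$: $$|\mathrm{Cay}_X[n]|=|\mathrm{Cay}[n-1]|.$$ (ii) For $n\ge 0$, the number of Cayley permutations of $[n]$ whose functional digraph is a forest equals $$|\mathrm{Cay}_E[n]|=\sum_{r=0}^n\frac{1}{r!}\sum_{i=0}^n i!\left\{\frac{n}{i}\right\}_r.$$ (iii) For $n\ge 0$, the number of Cayley permutations of $[n]$ whose functional digraph is connected equals $$|\mathrm{Cay}_{\mathcal{C}}[n]|=\sum_{r=1}^n\frac{1}{r}\sum_{i=0}^n i!\left\{\frac{n}{i}\right\}_r.$$
   Context: $[n]=\{1,\dots,n\}$, $[0]=\emptyset$. A Cayley permutation of $[n]$ is a function $f:[n]\to[n]$ with $\mathrm{Im}(f)=[k]$ for some $k\le n$; $|\mathrm{Cay}[n]|$ denotes their number. The functional digraph of $f$ has vertex set $[n]$ and directed edges $(u,f(u))$, $u\in[n]$. A point $u$ is recurrent if $f^k(u)=u$ for some $k\ge1$. The functional digraph is a tree if it is a (nonempty) connected digraph whose only cycle is a loop (exactly one recurrent point, which is a fixed point); it is a forest if every recurrent point is a fixed point (all cycles are loops); it is connected if it is nonempty and weakly connected, i.e. the recurrent points form a single cycle. For $n,m,r\ge 0$, the $r$-Stirling number of the second kind $\left\{{n\atop m}\right\}_r$ is the number of set partitions of $[n]$ into $m$ blocks such that $1,2,\dots,r$ lie in distinct blocks, with the convention that it is $0$ if $r>n$.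 Define $$\left\{\frac{n}{m}\right\}_r=\left\{{n\atop m}\right\}_r-\left\{{n\atop m}\right\}_{r+1}.$$ *)

(* Defs.v *)
From mathcomp Require Import all_boot all_order all_algebra.
Set Implicit Arguments.
Unset Strict Implicit.
Unset Printing Implicit Defensive.
Import GRing.Theory.

(* The set {1, ..., n} is represented by 'I_n = {0, ..., n - 1}; thus the     *)
(* initial segment {1, ..., k} becomes [set i : 'I_n | i < k].                *)

Definition cayley n (f : {ffun 'I_n -> 'I_n}) : bool :=
  [exists k : 'I_n.+1, f @: setT == [set i : 'I_n | i < k]].

(* See recurrentP: fconnect allows zero steps, so one step is taken first.    *)
Definition recurrent n (f : {ffun 'I_n -> 'I_n}) (u : 'I_n) : bool :=
  fconnect f (f u) u.

Lemma recurrentP n (f : {ffun 'I_n -> 'I_n}) (u : 'I_n) :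
  reflect (exists2 k, 0 < k & iter k f u = u) (recurrent f u).
Proof.
apply: (iffP idP) => [/iter_findex fu | [[//|k] _ fu]].
  by exists (findex f (f u) u).+1; rewrite // iterSr.
by rewrite /recurrent -{2}fu iterSr fconnect_iter.
Qed.

Definition undirected_edge n (f : {ffun 'I_n -> 'I_n}) : rel 'I_n :=
  [rel u v | (f u == v) || (f v == u)].

Definition connected_digraph n (f : {ffun 'I_n -> 'I_n}) : bool :=
  (0 < n) && [forall u, forall v, connect (undirected_edge f) u v].

Definition tree_digraph n (f : {ffun 'I_n -> 'I_n}) : bool :=
  connected_digraph f &&
  [exists u, (f u == u) && [forall v, recurrent f v == (v == u)]].

Definition forest_digraph n (f : {ffun 'I_n -> 'I_n}) : bool :=
  [forall u, recurrent f u ==> (f u == u)].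

Definition Cay n := [set f : {ffun 'I_n -> 'I_n} | cayley f].
Definition CayTree n := [set f in Cay n | tree_digraph f].
Definition CayForest n := [set f in Cay n | forest_digraph f].
Definition CayConnected n := [set f in Cay n | connected_digraph f].

Definition rStirling2 (r n m : nat) : nat :=
  #|[set P : {set {set 'I_n}} |
      [&& r <= n, partition P [set: 'I_n], #|P| == m &
        [forall i : 'I_n, forall j : 'I_n,
          [&& i < r, j < r & i != j] ==> (pblock P i != pblock P j)]]]|.

Definition rStirling2_diff (r n m : nat) : rat :=
  ((rStirling2 r n m)%:R - (rStirling2 r.+1 n m)%:R)%R.

(* Main.v *)
(**
Fix S with |S| = k and count the functions f : [n] -> S.  Given R in S with
|R| = r and a permutation p of R, k^(n-r) of them agree with p on R.  Sorting
these by their recurrent set R' and by the permutation p' of R' that they induce,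
where (R', p') extends (R, p), gives a triangular system for the number of f with
recurrent set R and permutation p.  Its solution k^(n-r) - (k-r) k^(n-r-1) depends
only on k and r.  Multiplied by the falling factorial of k of length r, it is the
number of words [n] -> S whose first r letters are distinct but whose first r + 1
letters are not.  So those words are r! times as many as the forests, and r times
as many as the connected functions, with r recurrent points.  Moebius inversion
over S carries this over to functions with image exactly S, and a word with image
of size i is a set partition into i blocks together with a labelling of its blocks,
which brings in i! and the r-Stirling numbers.
*)
Require Import Defs.
From mathcomp Require Import all_boot all_order all_algebra fingroup perm zify.
Set Implicit Arguments.
Unset Strict Implicit.
Unset Printing Implicit Defensive.

(** * Sums over subsets, and functions with constrained values *)

Lemma sum_subset_card (T : finType) (U : {set T}) (phi : nat -> nat) :
  \sum_(X : {set T} | X \subset U) phi #|X|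
    = \sum_(j < #|U|.+1) 'C(#|U|, j) * phi j.
Proof.
rewrite (partition_big (fun X : {set T} => inord #|X| : 'I_#|U|.+1) xpredT) //=.
apply: eq_bigr => j _; rewrite -(cards_draws U j) -sum_nat_const.
rewrite [RHS](eq_bigl (fun X : {set T} => (X \subset U) && (#|X| == j))); last first.
  by move=> X; rewrite inE.
have eqj (X : {set T}) : X \subset U -> (inord #|X| == j) = (#|X| == j).
  by move=> /subset_leq_card leXU; rewrite -val_eqE /= inordK.
rewrite (eq_bigl (fun X : {set T} => (X \subset U) && (#|X| == j))) => [|X].
  by apply: eq_bigr => X /andP[_ /eqP->].
by case: (boolP (X \subset U)) => //= /eqj ->.
Qed.

(** Moebius inversion on the subset lattice, stated as uniqueness so that it stays in [nat]: by
    strong induction on #|S|, all terms but X = S cancel. *)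
Lemma subset_sum_inj (T : finType) (a b : {set T} -> nat) (N : nat) :
  (forall S : {set T}, #|S| <= N ->
     \sum_(X : {set T} | X \subset S) a X
       = \sum_(X : {set T} | X \subset S) b X) ->
  forall S : {set T}, #|S| <= N -> a S = b S.
Proof.
move=> eq_sum S; have [m] := ubnP #|S|.
elim: m S => // m IH S ltSm leSN; have := eq_sum S leSN.
rewrite (bigD1 S) //= [RHS](bigD1 S) //=.
rewrite (eq_bigr b) => [/addIn //|X /andP[sXS neXS]].
have ltXS: #|X| < #|S| by apply: proper_card; rewrite properEneq neXS.
by apply: IH; [apply: leq_trans ltXS _ | apply: leq_trans (ltnW ltXS) leSN].
Qed.

Lemma card_value_subset (A : finType) (T : finType) (im : A -> {set T})
    (P : pred A) (S : {set T}) :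
  #|[set f | P f && (im f \subset S)]|
    = \sum_(X : {set T} | X \subset S) #|[set f | P f && (im f == X)]|.
Proof.
rewrite -sum1dep_card (partition_big im (fun X => X \subset S)) /=; last first.
  by move=> f /andP[].
apply: eq_bigr => X sXS; rewrite -sum1dep_card; apply: eq_bigl => f.
by case: (im f =P X) => [->|]; rewrite ?sXS ?andbT ?andbF.
Qed.

Lemma imset_subP (aT rT : finType) (f : aT -> rT) (S : {set rT}) :
  reflect (forall x, f x \in S) (f @: [set: aT] \subset S).
Proof.
apply: (iffP subsetP) => [h x | h _ /imsetP[x _ ->]]; last exact: h.
by apply: h; apply: imset_f.
Qed.

Lemma card_ffun_agree (aT rT : finType) (D : {set aT}) (S : {set rT})
    (h : aT -> rT) :
  {in D, forall x, h x \in S} ->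
  #|[set f : {ffun aT -> rT} |
      [forall x in D, f x == h x] && (f @: setT \subset S)]|
    = #|S| ^ (#|aT| - #|D|).
Proof.
move=> hS; pose F x : pred rT := if x \in D then pred1 (h x) else mem S.
transitivity #|family F|.
  rewrite cardsE; apply: eq_card => f; rewrite !inE.
  apply/andP/familyP => [[/forall_inP fD /imset_subP fS] x | fF].
    by rewrite /F; case: ifPn => [/fD|_]; rewrite ?inE //; apply: fS.
  split; first by apply/forall_inP => x Dx; have := fF x; rewrite /F Dx.
  apply/imset_subP => x; have := fF x; rewrite /F.
  by case: ifPn => [Dx /eqP-> |_]; rewrite ?hS.
rewrite card_family foldrE big_image /=.
rewrite (bigID (mem D)) /= big1 => [|x Dx]; last by rewrite /F Dx card1.
rewrite mul1n (eq_bigr (fun=> #|S|)) => [|x nDx]; last by rewrite /F (negbTE nDx).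
rewrite prod_nat_const -(cardsC D) addKn; congr (_ ^ _).
by apply: eq_card => x; rewrite !inE.
Qed.

(** * Recurrent points and the permutation induced on them *)

Section Recurrence.
Variables (n : nat).
Implicit Types (f : {ffun 'I_n -> 'I_n}) (R S : {set 'I_n}) (s : {perm 'I_n}).

Definition rec f : {set 'I_n} := [set u | recurrent f u].

Lemma in_rec f u : (u \in rec f) = recurrent f u. Proof. by rewrite inE. Qed.

Lemma rec_closed f u : u \in rec f -> f u \in rec f.
Proof.
rewrite !in_rec => /recurrentP[k k0 fku]; apply/recurrentP; exists k => //.
by rewrite -iterSr iterS fku.
Qed.

(** If x and y have periods a and b, both return after b * a steps; this number is positive and the
    two paths merge after one step, so x = y. *)
Lemma rec_inj f : {in rec f &, injective f}.
Proof.
move=> x y; rewrite !in_rec => /recurrentP[a a0 fx] /recurrentP[b b0 fy] eqf.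
have iterM z m k : iter m f z = z -> iter (k * m) f z = z.
  by move=> fz; elim: k => // k IH; rewrite mulSn iterD IH.
have:= iterM _ _ b fx; have:= iterM _ _ a fy; rewrite mulnC.
have: 0 < b * a by rewrite muln_gt0 a0 b0.
by case: (b * a) => // k _; rewrite !iterSr -eqf => -> ->.
Qed.

Lemma rec_sub_im f : rec f \subset f @: setT.
Proof.
apply/subsetP => u; rewrite in_rec => /recurrentP[[//|k] _ <-].
by rewrite iterS imset_f.
Qed.

(** The path from u closes up at some earlier iterate i, which then has [order f u - i] as a
    period. *)
Lemma fconnect_rec f u : exists2 v, v \in rec f & fconnect f u v.
Proof.
have /trajectP[i lti eqi] := looping_order f u.
exists (iter i f u); last exact: fconnect_iter.
rewrite in_rec; apply/recurrentP; exists (fingraph.order f u - i).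
  by rewrite subn_gt0.
by rewrite -iterD subnK // ltnW.
Qed.

Lemma agree_sub_rec f R s : perm_on R s ->
  {in R, forall x, f x = s x} -> R \subset rec f.
Proof.
move=> Rs fs; apply/subsetP => x Rx; rewrite in_rec; apply/recurrentP.
exists (fingraph.order s x); first exact: fingraph.order_gt0.
rewrite -[RHS](iter_order (@perm_inj _ s)).
elim: (fingraph.order s x) => // i IH; rewrite !iterS IH fs //.
elim: {IH} i => [|i IH] //=; by rewrite (perm_closed _ Rs).
Qed.

(** Extended by the identity off [rec f], so that the induced permutation lives in [{perm 'I_n}] for
    every f. *)
Definition rec_fun f x := if x \in rec f then f x else x.

Lemma rec_fun_inj f : injective (rec_fun f).
Proof.
move=> x y; rewrite /rec_fun; case: ifPn => rx; case: ifPn => ry //.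
- exact: rec_inj.
- by move=> eqy; rewrite -eqy rec_closed in ry.
- by move=> eqy; rewrite eqy rec_closed in rx.
Qed.

Definition rec_perm f : {perm 'I_n} := perm (@rec_fun_inj f).

Lemma rec_permE f : {in rec f, forall x, f x = rec_perm f x}.
Proof. by move=> x rx; rewrite permE /rec_fun rx. Qed.

Lemma rec_perm_on f : perm_on (rec f) (rec_perm f).
Proof.
by apply/subsetP => x; rewrite inE permE /rec_fun; case: ifP => // _; rewrite eqxx.
Qed.

Lemma rec_perm_eq f s : perm_on (rec f) s ->
  (rec_perm f == s) = [forall x in rec f, f x == s x].
Proof.
move=> fs; apply/eqP/forall_inP => [<- x rx | eqs]; first by rewrite rec_permE.
apply/permP => x; have [rx|nrx] := boolP (x \in rec f).
  by rewrite -rec_permE //; apply/eqP/eqs.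
by rewrite (out_perm (rec_perm_on f)) // (out_perm fs).
Qed.

End Recurrence.

(** * Functions with a given recurrent set and a given permutation on it *)

(** Composing with the inverse of s turns the extensions of s into the permutations supported on R'
    :\: R. *)
Lemma card_perm_extend (T : finType) (R R' : {set T}) (s : {perm T}) :
  R \subset R' -> perm_on R s ->
  #|[set s' : {perm T} | perm_on R' s' && [forall x in R, s' x == s x]]|
    = #|R' :\: R|`!.
Proof.
move=> sRR' Rs; rewrite -card_perm -[RHS](card_imset _ (mulIg s)).
apply: eq_card => s'; rewrite inE; apply/andP/imsetP => [[R's' /forall_inP eqs]|].
  exists (s' * s^-1)%g; last by rewrite mulgKV.
  apply/subsetP => x; rewrite !inE permM; apply: contraR.
  rewrite negb_and negbK => /orP[Rx | nR'x]; first by rewrite (eqP (eqs x Rx)) permK.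
  have nRx: x \notin R by apply: contra nR'x; apply: (subsetP sRR').
  rewrite (out_perm R's') //.
  by rewrite -{1}(out_perm Rs nRx) permK.
case=> q Dq ->; split.
  apply: perm_onM; first by apply: subset_trans Dq (subsetDl _ _).
  exact: subset_trans Rs sRR'.
apply/forall_inP => x Rx; rewrite permM (out_perm Dq) //.
by rewrite !inE Rx.
Qed.

(* The number of f : [n] -> S, |S| = k, with a given recurrent set of size r and a
   given permutation on it (see card_rec_agree); it simplifies to r * k^(n-r-1) when
   r < n, but this form also gives 1 when r = k = n. *)
Definition num_rec n k r := k ^ (n - r) - (k - r) * k ^ (n - r).-1.

(** The subtraction in [num_rec] never truncates. For r = n the hypothesis forces k = r, so the
    factor k - r kills the term whose exponent is the predecessor of 0. *)
Lemma num_rec_add n k r : r <= k <= n ->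
  num_rec n k r + (k - r) * k ^ (n - r).-1 = k ^ (n - r).
Proof.
case/andP=> le_rk le_kn; rewrite subnK //.
case E: (n - r) => [|m] /=; first by rewrite (_ : k - r = 0) //; lia.
by rewrite expnS leq_mul2r leq_subr orbT.
Qed.

(** [num_rec] solves the triangular system. With u = k - r, the j-th summand is u ^_ j * k^(n-r-j)
    minus the same expression at j + 1, so the sum telescopes, and the remainder contains u ^_ u.+1
    = 0. *)
Lemma sum_num_rec n k r : r <= k <= n ->
  \sum_(j < (k - r).+1) 'C(k - r, j) * (j`! * num_rec n k (r + j)) = k ^ (n - r).
Proof.
move=> /andP[le_rk le_kn]; set u := k - r.
under eq_bigr do rewrite mulnA bin_ffact.
suff tel m : m <= u.+1 -> \sum_(j < m) u ^_ j * num_rec n k (r + j)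
    + u ^_ m * k ^ (n - (r + m)) = k ^ (n - r).
  by rewrite -[RHS](tel u.+1) // ffact_small // mul0n addn0.
elim: m => [|m IH] lemu; first by rewrite big_ord0 ffactn0 addn0 mul1n.
rewrite -IH ?(ltnW lemu) // big_ord_recr /= -addnA; congr (_ + _).
rewrite ffactnSr -mulnA -mulnDr; congr (_ * _).
rewrite -[RHS]num_rec_add; last by move: lemu; rewrite /u; lia.
congr (_ + _ * _ ^ _); rewrite /u; lia.
Qed.

(** Induction on #|S| - #|R|: among all functions agreeing with s on R, those with a strictly larger
    recurrent set are already counted. *)
Lemma card_rec_agree n (S R : {set 'I_n}) (s : {perm 'I_n}) :
  R \subset S -> perm_on R s ->
  #|[set f : {ffun 'I_n -> 'I_n} |
      [&& rec f == R, [forall x in R, f x == s x] & f @: setT \subset S]]|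
    = num_rec n #|S| #|R|.
Proof.
have [m] := ubnP (#|S| - #|R|); elim: m R s => // m IH R s ltm sRS Rs.
set u := #|S| - #|R|.
have leRS := subset_leq_card sRS.
have leSn : #|S| <= n by rewrite -[X in _ <= X](card_ord n) max_card.
have cardD : #|S :\: R| = u by rewrite cardsD (setIidPr sRS).
have total : \sum_(X : {set 'I_n} | X \subset S :\: R)
    #|X|`! * num_rec n #|S| (#|R| + #|X|) = #|S| ^ (n - #|R|).
  rewrite (sum_subset_card _ (fun j => j`! * num_rec n #|S| (#|R| + j))).
  by rewrite cardD sum_num_rec // leRS.
have agreeS : {in R, forall x, s x \in S}.
  by move=> x Rx; apply: (subsetP sRS); rewrite (perm_closed _ Rs).
have := card_ffun_agree agreeS; rewrite card_ord -total -sum1dep_card.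
rewrite (partition_big (fun f => rec f)
  (fun R' => (R \subset R') && (R' \subset S))) /=; last first.
  move=> f /andP[/forall_inP fs fS]; rewrite (subset_trans (rec_sub_im f) fS) andbT.
  by apply: (agree_sub_rec Rs) => x Rx; apply/eqP/fs.
(* The recurrent set R' is encoded by X = R' :\: R, to match the sum in [total] term by term. *)
rewrite (reindex_onto (fun X => X :|: R) (fun R' => R' :\: R)) /=; last first.
  move=> R' /andP[sRR' _]; apply/setP=> x; rewrite !inE.
  by case: (boolP (x \in R)) => [/(subsetP sRR') ->|]; rewrite ?orbT ?orbF.
rewrite (eq_bigl (fun X : {set 'I_n} => X \subset S :\: R)) => [|X]; last first.
  rewrite subsetUr subUset sRS andbT /= setDUl setDv setU0 subsetD; congr (_ && _).
  by apply/eqP/setDidPl.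
(* X = set0 is the case R' = R, the unknown of the system; once the other terms agree they
   cancel. *)
rewrite (bigD1 set0) ?sub0set //= [RHS](bigD1 set0) ?sub0set //=.
rewrite cards0 fact0 mul1n addn0 set0U.
under eq_bigl do rewrite -andbA andbC -andbA.
rewrite sum1dep_card.
rewrite (eq_bigr (fun X : {set 'I_n} => #|X|`! * num_rec n #|S| (#|R| + #|X|))).
  move=> /eqP; rewrite eqn_add2r => /eqP <-; apply: eq_card => f; rewrite !inE.
  by rewrite andbA andbC.
move=> X /andP[]; rewrite subsetD => /andP[sXS disXR] neX0.
set R' := X :|: R.
have cardR' : #|R'| = #|R| + #|X|.
  by rewrite cardsU disjoint_setI0 // cards0 subn0 addnC.
have sR'S : R' \subset S by rewrite subUset sXS sRS.
have sRR' : R \subset R' := subsetUr _ _.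
have X0 : 0 < #|X| by rewrite card_gt0.
have DR' : R' :\: R = X by rewrite setDUl setDv setU0; apply/setDidPl.
rewrite -{1}DR' -(card_perm_extend sRR' Rs) -sum_nat_const -cardR'.
rewrite (partition_big (@rec_perm n) (mem [set s' : {perm 'I_n} |
    perm_on R' s' && [forall x in R, s' x == s x]])) /=.
  apply: eq_bigr => s'; rewrite inE => /andP[R's' /forall_inP eqs].
  rewrite -(IH R' s') //; last by have := subset_leq_card sR'S; lia.
  rewrite sum1dep_card; apply: eq_card => f; rewrite !inE.
  have [recf|] := eqVneq (rec f) R'; last by rewrite andbF.
  rewrite rec_perm_eq ?recf //= andbT.
  case: (boolP [forall x in R', _]) => [/forall_inP fs'|]; rewrite ?andbF ?andbT //.
  rewrite (_ : [forall x in R, _] = true) //; apply/forall_inP => x Rx.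
  by rewrite -(eqP (eqs x Rx)); apply/fs'/(subsetP sRR').
move=> f /andP[/andP[/forall_inP fs fS] /eqP recf]; rewrite inE -recf rec_perm_on.
apply/forall_inP => x Rx; rewrite -rec_permE ?recf ?(subsetP sRR') //; exact: fs.
Qed.

(** * Forests and connected functions with r recurrent points *)

(** A forest is a function inducing the identity on its recurrent set, so [card_rec_agree] is
    applied with s = 1 to each r-subset R of S. *)
Lemma card_forest_sub n (S : {set 'I_n}) r :
  r`! * #|[set f : {ffun 'I_n -> 'I_n} |
            (forest_digraph f && (#|rec f| == r)) && (f @: setT \subset S)]|
    = #|S| ^_ r * num_rec n #|S| r.
Proof.
rewrite -bin_ffact mulnAC [LHS]mulnC; congr (_ * _).
rewrite -(cards_draws S r) -sum_nat_const -sum1dep_card.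
rewrite (partition_big (@rec n)
  (mem [set R : {set 'I_n} | R \subset S & #|R| == r])) /=.
  apply: eq_bigr => R; rewrite inE => /andP[sRS /eqP cardR].
  rewrite -cardR -(card_rec_agree sRS (perm_on1 _)) sum1dep_card.
  apply: eq_card => f; rewrite !inE.
  have [recf|] := eqVneq (rec f) R; last by rewrite andbF.
  rewrite recf cardR eqxx !andbT /=; congr (_ && _).
  by apply: eq_forallb => x; rewrite -in_rec recf perm1.
by move=> f /andP[/andP[_ cardf] fS]; rewrite inE cardf (subset_trans (rec_sub_im f) fS).
Qed.

(** For recurrent v, the points leading to v are closed under edges in both directions, since f v
    still leads to v. Conversely, every point leads to a recurrent one. *)
Lemma connected_digraphE n (f : {ffun 'I_n -> 'I_n}) :
  connected_digraph f =
    (0 < n) && [forall u in rec f, forall v in rec f, fconnect f u v].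
Proof.
have sym_e : connect_sym (undirected_edge f).
  by apply: sym_connect_sym => u v; apply: orbC.
have sub_e : subrel (fconnect f) (connect (undirected_edge f)).
  by apply: connect_sub => u v /= uv; apply: connect1; apply/orP; left.
rewrite /connected_digraph; congr (_ && _); apply/idP/idP.
  move=> /forallP conn; apply/forall_inP => u ru; apply/forall_inP => v rv.
  suff cl : closed (undirected_edge f) [pred w | fconnect f w v].
    have := closed_connect cl (forallP (conn u) v); by rewrite !inE connect0.
  have step w : fconnect f (f w) v = fconnect f w v.
    apply/idP/idP => [|wv]; first by apply: connect_trans; apply: fconnect1.
    case/iter_findex: wv; case: findex => [/= ->|k].
      by move: rv; rewrite in_rec.
    by rewrite iterSr => <-; apply: fconnect_iter.
  by move=> a b /= /orP[] /eqP <-; rewrite !inE step.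
move=> /forall_inP conn; apply/forallP => u; apply/forallP => v.
have [u' ru' uu'] := fconnect_rec f u; have [v' rv' vv'] := fconnect_rec f v.
apply: connect_trans (sub_e _ _ uu') _; rewrite sym_e.
apply: connect_trans (sub_e _ _ vv') _; apply: sub_e.
exact: (forall_inP (conn v' rv')).
Qed.

(* Each tuple lists the unique cycle from one of its r starting points. *)
Lemma card_connected_cycles n (f : {ffun 'I_n -> 'I_n}) r : 0 < r ->
  #|[set t : r.-tuple 'I_n | [&& uniq t, fcycle f t & rec f == [set x in t]]]|
    = r * (connected_digraph f && (#|rec f| == r)).
Proof.
case: r => // r _; set A := [set t | _].
have inA t : t \in A -> [/\ uniq t, fcycle f t & rec f = [set x in t]].
  by rewrite inE => /and3P[? ? /eqP].
have headA (t : r.+1.-tuple _) : t \in A -> thead t \in tval t by move=> _; apply: mem_tnth.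
case: (boolP (_ && _)) => [/andP[cf /eqP cardf]|ncf]; last first.
  rewrite muln0; apply/eqP; rewrite cards_eq0; apply: contraR ncf.
  case/set0Pn => t At; have [Ut ct rt] := inA t At.
  rewrite connected_digraphE rt cardsE (card_uniqP Ut) size_tuple eqxx andbT.
  rewrite (leq_ltn_trans _ (ltn_ord (thead t))) //=.
  apply/forall_inP => u; rewrite inE => tu; apply/forall_inP => v; rewrite inE.
  by rewrite (fconnect_cycle ct).
(* A listing in A is the orbit of its head, hence determined by it; the possible heads are the
   recurrent points. *)
have thead_inj : {in A &, injective (@thead r 'I_n)}.
  suff orb (t : r.+1.-tuple _) : t \in A -> tval t = orbit f (thead t).
    by move=> s t As At eqst; apply: val_inj; rewrite /= (orb s As) eqst -orb.
  move=> At; have [Ut ct _] := inA t At.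
  rewrite (orbitE ct Ut (headA t At)) (_ : index _ _ = 0) ?rot0 //.
  by case/tupleP: t {At Ut ct} => x t; rewrite theadE /= eqxx.
rewrite muln1 -[RHS]cardf -(card_in_imset thead_inj); apply: eq_card => x.
apply/imsetP/idP => [[t At ->]|rx].
  by have [_ _ ->] := inA t At; rewrite inE headA.
have cx : fcycle f (orbit f x) by rewrite -fconnect_f; move: rx; rewrite in_rec.
have eqrec : rec f = [set y in orbit f x].
  apply/setP => y; rewrite [RHS]inE -fconnect_orbit; apply/idP/idP => [ry|xy].
    move: cf; rewrite connected_digraphE => /andP[_ /forall_inP/(_ x rx)/forall_inP].
    exact.
  rewrite in_rec /recurrent fconnect_f.
  have yx : y \in orbit f x by rewrite -fconnect_orbit.
  exact: (cycle_orbit_cycle cx).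
have sz : size (orbit f x) == r.+1.
  by rewrite -cardf eqrec cardsE (card_uniqP (orbit_uniq f x)).
exists (Tuple sz); first by rewrite inE /= orbit_uniq cx eqrec eqxx.
by rewrite /thead (tnth_nth x) /= /orbit -orderSpred.
Qed.

(** Double counting of pairs (f, t) with t a listing of the cycle of f: each f has r listings, and
    each uniq t over S occurs for [num_rec n #|S| r] functions. *)
Lemma card_connected_sub n (S : {set 'I_n}) r : 0 < r ->
  r * #|[set f : {ffun 'I_n -> 'I_n} |
          (connected_digraph f && (#|rec f| == r)) && (f @: setT \subset S)]|
    = #|S| ^_ r * num_rec n #|S| r.
Proof.
move=> r0; rewrite -(card_uniq_tuples r (mem S)) -sum_nat_const.
rewrite -sum1dep_card big_distrr /=.
transitivity (\sum_(f : {ffun 'I_n -> 'I_n} | f @: setT \subset S)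
  \sum_(t : r.-tuple 'I_n | [&& uniq t, fcycle f t & rec f == [set x in t]]) 1).
  rewrite [RHS](eq_bigr (fun f => r * (connected_digraph f && (#|rec f| == r)))).
    rewrite [RHS](bigID (fun f => connected_digraph f && (#|rec f| == r))) /=.
    rewrite [X in _ = _ + X]big1 => [|f /andP[_ /negbTE->]]; last by rewrite muln0.
    rewrite addn0; apply: eq_big => f; first by rewrite andbC.
    by case/andP=> ->.
  by move=> f _; rewrite sum1dep_card card_connected_cycles.
rewrite (exchange_big_dep (fun t : r.-tuple 'I_n =>
    t \in [set t : r.-tuple 'I_n | all (mem S) t & uniq t])) /=.
  apply: eq_bigr => t; rewrite inE => /andP[/allP tS Ut].
  (* [next t] rotates the entries of t and fixes all else; t is a cycle of f exactly when f agrees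
     with it on t. *)
  pose s := perm (can_inj (prev_next Ut)).
  have sRS : [set x in t] \subset S by apply/subsetP => x; rewrite inE => /tS.
  have Rs : perm_on [set x in t] s.
    apply/subsetP => x; rewrite !inE permE next_nth.
    by case: ifP => //; rewrite eqxx.
  have cardt : #|[set x in t]| = r by rewrite cardsE (card_uniqP Ut) size_tuple.
  rewrite -[X in num_rec _ _ X]cardt -(card_rec_agree sRS Rs) sum1dep_card.
  apply: eq_card => f; rewrite !inE Ut /= andbC -andbA andbCA; congr [&& _, _ & _].
  apply/idP/forall_inP => [ct x|eqs].
    by rewrite inE permE => tx; apply: (next_cycle ct tx).
  rewrite (@eq_in_cycle _ (mem t) _ (frel (next t))) ?cycle_next //.
  by move=> x y tx _ /=; have := eqs x; rewrite inE permE => /(_ tx) /eqP ->.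
move=> f t fS /and3P[Ut ct /eqP rt]; rewrite inE Ut andbT.
apply/allP => x tx; apply: (subsetP (subset_trans (rec_sub_im f) fS)).
by rewrite rt inE.
Qed.

(** * Words whose first r letters are distinct *)

(** The conjunct r <= n mirrors the convention that r-Stirling numbers vanish for r > n. *)
Definition prefix_inj n r (f : 'I_n -> 'I_n) :=
  (r <= n) && [forall i : 'I_n, forall j : 'I_n,
    [&& i < r, j < r & i != j] ==> (f i != f j)].

Lemma card_initial n r : r <= n -> #|[set i : 'I_n | i < r]| = r.
Proof.
move=> le_rn; rewrite -[RHS](card_ord r) -cardsT.
have wI : injective (widen_ord le_rn) by move=> i j /(congr1 val) /= /val_inj.
rewrite -(card_imset _ wI); apply: eq_card => i; rewrite inE.
apply/idP/imsetP => [lt_ir|[j _ ->]]; last exact: (ltn_ord j).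
by exists (Ordinal lt_ir) => //; apply: val_inj.
Qed.

Lemma card_prefix_inj_sub n r (S : {set 'I_n}) : r <= n ->
  #|[set f : {ffun 'I_n -> 'I_n} | prefix_inj r f && (f @: setT \subset S)]|
    = #|S| ^_ r * #|S| ^ (n - r).
Proof.
move=> le_rn; rewrite -(card_uniq_tuples r (mem S)) -sum_nat_const -sum1dep_card.
pose init (f : {ffun 'I_n -> 'I_n}) : r.-tuple 'I_n :=
  [tuple f (widen_ord le_rn i) | i < r].
have nthE (f : {ffun 'I_n -> 'I_n}) (x : 'I_n) : x < r -> nth x (init f) x = f x.
  move=> ltx; rewrite -[X in nth x _ X]/(val (Ordinal ltx)) -tnth_nth tnth_mktuple.
  by congr (f _); apply: val_inj.
rewrite (partition_big init (mem [set t : r.-tuple 'I_n | all (mem S) t & uniq t])) /=.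
  apply: eq_bigr => t; rewrite inE => /andP[/allP tS Ut].
  have hS : {in [set i : 'I_n | i < r], forall x, nth x t x \in S}.
    by move=> x; rewrite inE => ltx; apply/tS/mem_nth; rewrite size_tuple.
  have := card_ffun_agree hS; rewrite card_ord card_initial // => <-.
  rewrite sum1dep_card; apply: eq_card => f; rewrite !inE andbAC; congr (_ && _).
  apply/andP/forall_inP => [[_ /eqP <-] x|agr].
    by rewrite inE => ltx; rewrite nthE.
  have fE (x : 'I_n) : x < r -> f x = nth x t x.
    by move=> ltx; apply/eqP/agr; rewrite inE.
  split.
    rewrite /prefix_inj le_rn; apply/forallP => i; apply/forallP => j.
    apply/implyP => /and3P[lti ltj]; rewrite !fE // (set_nth_default j) ?size_tuple //.
    by rewrite nth_uniq ?size_tuple.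
  apply/eqP/eq_from_tnth => i; rewrite tnth_mktuple fE //=.
  by rewrite (tnth_nth (widen_ord le_rn i)).
move=> f /andP[/andP[_ /forallP finj] /imset_subP fS]; rewrite inE.
apply/andP; split; first by apply/allP => _ /mapP[i _ ->]; apply: fS.
rewrite map_inj_uniq ?enum_uniq // => i j; apply: contra_eq => ne_ij.
have /implyP := forallP (finj (widen_ord le_rn i)) (widen_ord le_rn j).
by apply; rewrite /= !ltn_ord.
Qed.

(** The weight w will be r! for forests and r for connected functions. Summed over X inside S, the
    identity is [num_rec_add] multiplied by #|S| ^_ r; [subset_sum_inj] then passes to exact
    images. *)
Lemma card_rec_prefix_inj n (P : pred {ffun 'I_n -> 'I_n}) w r :
  r <= n ->
  (forall S : {set 'I_n},
     w * #|[set f | P f && (f @: setT \subset S)]| = #|S| ^_ r * num_rec n #|S| r) ->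
  forall X : {set 'I_n},
    w * #|[set f | P f && (f @: setT == X)]|
      + #|[set f : {ffun 'I_n -> 'I_n} | prefix_inj r.+1 f && (f @: setT == X)]|
    = #|[set f : {ffun 'I_n -> 'I_n} | prefix_inj r f && (f @: setT == X)]|.
Proof.
move=> le_rn wP X.
have leSn (S : {set 'I_n}) : #|S| <= n by rewrite -[X in _ <= X](card_ord n) max_card.
pose im (f : {ffun 'I_n -> 'I_n}) := f @: setT.
pose a (Y : {set 'I_n}) := w * #|[set f | P f && (im f == Y)]|
  + #|[set f : {ffun 'I_n -> 'I_n} | prefix_inj r.+1 f && (im f == Y)]|.
pose b (Y : {set 'I_n}) :=
  #|[set f : {ffun 'I_n -> 'I_n} | prefix_inj r f && (im f == Y)]|.
refine (@subset_sum_inj _ a b n _ X (leSn X)) => S _; rewrite {}/a {}/b.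
rewrite big_split /= -big_distrr /= -!card_value_subset wP.
rewrite [in RHS]card_prefix_inj_sub //.
(* This also covers r = n: no word has a prefix of length n + 1, and the falling factorial vanishes
   because #|S| <= n. *)
have -> : #|[set f : {ffun 'I_n -> 'I_n} | prefix_inj r.+1 f && (im f \subset S)]|
    = #|S| ^_ r.+1 * #|S| ^ (n - r).-1.
  rewrite -subnS; have [/card_prefix_inj_sub-> //|lt_nr] := leqP r.+1 n.
  rewrite ffact_small ?(leq_ltn_trans (leSn S)) // mul0n.
  by apply: eq_card0 => f; rewrite inE /prefix_inj leqNgt lt_nr.
rewrite ffactnSr -mulnA -mulnDr.
have [le_rS|lt_Sr] := leqP r #|S|; first by rewrite num_rec_add // le_rS leSn.
by rewrite ffact_small.
Qed.

(** * Words with exact image as labelled set partitions *)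

Lemma pblock_preim_partition (aT rT : finType) (f : aT -> rT) x y :
  (pblock (preim_partition f setT) x == pblock (preim_partition f setT) y)
    = (f x == f y).
Proof.
have /and3P[/eqP cov tI _] := preim_partitionP f setT.
rewrite eq_pblock ?cov ?inE // pblock_equivalence_partition ?inE //.
by move=> a b c _ _ _; split; [exact: eqxx | move/eqP=> ->].
Qed.

Lemma card_preim_partition (aT rT : finType) (f : aT -> rT) :
  #|preim_partition f setT| = #|f @: [set: aT]|.
Proof.
have -> : preim_partition f setT = (fun y => [set x | f x == y]) @: (f @: setT).
  rewrite -imset_comp; apply: eq_imset => x /=; apply/setP => y.
  by rewrite !inE eq_sym.
apply: card_in_imset => y z /imsetP[x _ ->] _ /setP/(_ x).
by rewrite !inE eqxx => /esym/eqP.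
Qed.

(** Such f are the composites of the block map [blk] with an injection of the blocks into X; as #|Q|
    = #|X|, these injections are bijections. *)
Lemma card_preim_partition_fiber (aT rT : finType) (Q : {set {set aT}})
    (X : {set rT}) :
  partition Q setT -> #|Q| = #|X| ->
  #|[set f : {ffun aT -> rT} |
      (preim_partition f setT == Q) && (f @: setT == X)]| = #|X|`!.
Proof.
move=> partQ cardQ; have [/eqP cov tI nQ0] := and3P partQ.
have memQ x : pblock Q x \in Q by rewrite pblock_mem // cov.
pose blk x : {B | B \in Q} := exist (fun B => B \in Q) _ (memQ x).
have blkE (B : {B | B \in Q}) x : x \in val B -> blk x = B.
  by move=> Bx; apply: val_inj; apply: (def_pblock tI (valP B)).
have blk_surj B : exists x, blk x = B.
  have /set0Pn[x Bx] : val B != set0 by apply: contraNneq nQ0 => <-; apply: valP.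
  by exists x; apply: blkE.
pose lift (g : {ffun {B | B \in Q} -> rT}) : {ffun aT -> rT} := [ffun x => g (blk x)].
have lift_inj : injective lift.
  move=> g h eqgh; apply/ffunP => B; have [x <-] := blk_surj B.
  by have := congr1 (fun l : {ffun aT -> rT} => l x) eqgh; rewrite !ffunE.
have cardQ' : #|{: {B | B \in Q}}| = #|X| by rewrite card_sig.
rewrite -ffactnn -{2}cardQ' -card_inj_ffuns_on -(card_imset _ lift_inj).
apply: eq_card => f; rewrite inE; apply/andP/imsetP => [[/eqP fQ /eqP fX]|].
  have /fin_all_exists[g gE] (B : {B | B \in Q}) :
      exists y, forall x, blk x = B -> f x = y.
    have [x xB] := blk_surj B; exists (f x) => z zB.
    apply/eqP; rewrite -pblock_preim_partition fQ; apply/eqP.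
    exact: (congr1 val (etrans zB (esym xB))).
  exists (finfun g); last by apply/ffunP => x; rewrite !ffunE; apply: gE.
  rewrite inE; apply/andP; split.
    apply/ffun_onP => B; rewrite ffunE; have [x xB] := blk_surj B.
    by rewrite -(gE B x xB) -fX imset_f.
  apply/injectiveP => B C; rewrite !ffunE.
  have [[x xB] [y yC]] := (blk_surj B, blk_surj C).
  rewrite -(gE B x xB) -(gE C y yC) => /eqP.
  rewrite -pblock_preim_partition fQ => /eqP eqb.
  by rewrite -xB -yC; apply: val_inj.
case=> g; rewrite inE => /andP[/ffun_onP gX /injectiveP ginj] ->.
have eqQ : preim_partition (lift g) setT = Q.
  rewrite -[RHS](preim_partition_pblock partQ); apply: eq_imset => x.
  apply/setP => y; rewrite !inE /= !ffunE (inj_eq ginj) -(inj_eq val_inj) //.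
split; first exact/eqP.
rewrite eqEcard -card_preim_partition eqQ cardQ leqnn andbT.
by apply/imset_subP => x; rewrite ffunE; apply: gX.
Qed.

Lemma card_prefix_inj_im n r (X : {set 'I_n}) :
  #|[set f : {ffun 'I_n -> 'I_n} | prefix_inj r f && (f @: setT == X)]|
    = #|X|`! * rStirling2 r n #|X|.
Proof.
rewrite mulnC -sum_nat_const -sum1dep_card.
rewrite (partition_big (fun f : {ffun 'I_n -> 'I_n} => preim_partition f setT)
  (mem [set Q : {set {set 'I_n}} | [&& r <= n, partition Q setT, #|Q| == #|X| &
    [forall i : 'I_n, forall j : 'I_n,
       [&& i < r, j < r & i != j] ==> (pblock Q i != pblock Q j)]]])) /=.
  apply: eq_bigr => Q; rewrite inE => /and4P[le_rn partQ /eqP cardQ sepQ].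
  rewrite -(card_preim_partition_fiber partQ cardQ) sum1dep_card.
  apply: eq_card => f; rewrite !inE andbC.
  have [fQ|] //= := eqVneq; rewrite -[RHS]andTb; congr (_ && _).
  rewrite /prefix_inj le_rn; apply/forallP => i; apply/forallP => j.
  by rewrite -pblock_preim_partition fQ; apply: (forallP (forallP sepQ i)).
move=> f /andP[/andP[-> /forallP finj] /eqP fX]; rewrite inE preim_partitionP /=.
rewrite card_preim_partition fX eqxx; apply/forallP => i; apply/forallP => j.
by rewrite pblock_preim_partition; apply: (forallP (finj i)).
Qed.

(** * Cayley permutations by image size and by number of recurrent points *)

Lemma card_Cay_sum n (P : pred {ffun 'I_n -> 'I_n}) :
  #|[set f in Cay n | P f]|
    = \sum_(k < n.+1) #|[set f | P f && (f @: setT == [set i : 'I_n | i < k])]|.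
Proof.
rewrite -sum1dep_card.
rewrite (partition_big (fun f : {ffun 'I_n -> 'I_n} =>
  inord #|f @: setT| : 'I_n.+1) xpredT) //=.
apply: eq_bigr => k _; rewrite -sum1dep_card; apply: eq_bigl => f.
have le_kn : k <= n by rewrite -ltnS.
rewrite inE andbAC andbC; congr (_ && _); apply/andP/eqP.
  case=> /existsP[j /eqP fj]; have le_jn : j <= n by rewrite -ltnS.
  by rewrite fj card_initial // inord_val => /eqP ->.
move=> fk; rewrite fk card_initial // inord_val eqxx; split=> //.
by apply/existsP; exists k; rewrite fk.
Qed.

Lemma card_Cay_rec n (P : pred {ffun 'I_n -> 'I_n}) w r : r <= n ->
  (forall S : {set 'I_n},
     w * #|[set f | P f && (f @: setT \subset S)]| = #|S| ^_ r * num_rec n #|S| r) ->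
  ((w * #|[set f in Cay n | P f]|)%:R
     = \sum_(0 <= i < n.+1) i`!%:R * rStirling2_diff r n i :> rat)%R.
Proof.
move=> le_rn wP; rewrite card_Cay_sum big_distrr GRing.natr_sum big_mkord /=.
apply: eq_bigr => k _; have le_kn : k <= n by rewrite -ltnS.
have := card_rec_prefix_inj le_rn wP [set i : 'I_n | i < k].
rewrite !card_prefix_inj_im card_initial // => eqk.
rewrite /rStirling2_diff GRing.mulrBr -!GRing.natrM -eqk GRing.natrD.
by rewrite GRing.addrK.
Qed.

Lemma card_Cay_split_rec n (P : pred {ffun 'I_n -> 'I_n}) :
  #|[set f in Cay n | P f]|
    = \sum_(r < n.+1) #|[set f in Cay n | P f && (#|rec f| == r)]|.
Proof.
have leSn (S : {set 'I_n}) : #|S| <= n by rewrite -[X in _ <= X](card_ord n) max_card.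
rewrite -sum1dep_card.
rewrite (partition_big (fun f => inord #|rec f| : 'I_n.+1) xpredT) //=.
apply: eq_bigr => r _; rewrite -sum1dep_card; apply: eq_bigl => f.
by rewrite -andbA -val_eqE /= inordK // ltnS.
Qed.

(** * Trees *)

(** A sole recurrent point is automatically fixed, because [rec f] is closed under f. *)
Lemma tree_digraphE n (f : {ffun 'I_n -> 'I_n}) :
  tree_digraph f = connected_digraph f && (#|rec f| == 1).
Proof.
rewrite /tree_digraph; congr (_ && _); apply/existsP/cards1P => [[u]|[u recu]].
  case/andP=> _ /forallP ru; exists u; apply/setP => v.
  by rewrite in_rec inE; apply/eqP.
have ru : u \in rec f by rewrite recu set11.
exists u; have := rec_closed ru; rewrite recu inE => -> /=.
by apply/forallP => v; rewrite -in_rec recu inE.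
Qed.

Lemma num_rec1 k m : k * num_rec m.+2 k 1 = k ^ m.+1.
Proof.
case: k => [|k]; first by rewrite mul0n exp0n.
rewrite /num_rec subn1 /= subn1 /= expnS -mulnBl.
by rewrite subSnn mul1n -expnS.
Qed.

(** By [num_rec1], trees on m + 2 points with image inside S are as many as all maps from m + 1
    points to S, namely #|S|^(m+1). Inversion over S, embedded by [wid], gives equality for each
    exact image. *)
Lemma card_CayTree_add2 m : #|CayTree m.+2| = #|Cay m.+1|.
Proof.
pose P (f : {ffun 'I_m.+2 -> 'I_m.+2}) := connected_digraph f && (#|rec f| == 1).
have -> : CayTree m.+2 = [set f in Cay m.+2 | P f].
  by apply/setP => f; rewrite !inE tree_digraphE.
have -> : Cay m.+1 = [set f in Cay m.+1 | xpredT f].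
  by apply/setP => f; rewrite !inE andbT.
(* The top term, a full image, is empty: f would be a bijection, with all m + 2 points recurrent
   instead of one. Both sums then have the same range. *)
rewrite !card_Cay_sum big_ord_recr /= [X in _ + X](_ : _ = 0) ?addn0; last first.
  apply: eq_card0 => f; rewrite !inE /=.
  apply/negP => /andP[/andP[_ /eqP rec1] /eqP fT].
  have fT' : f @: setT = setT by rewrite fT; apply/setP => x; rewrite !inE ltn_ord.
  have finj : injective f.
    have /imset_injP inj : #|f @: [set: 'I_m.+2]| == #|[set: 'I_m.+2]| by rewrite fT'.
    by move=> x y; apply: inj; rewrite inE.
  have recT : rec f = setT.
    by apply/setP => x; rewrite in_rec inE /recurrent fconnect_f cycle_orbit.
  by move: rec1; rewrite recT cardsT card_ord.
pose wid := widen_ord (leqnSn m.+1).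
have wid_inj : injective wid by move=> i j /(congr1 val) /= /val_inj.
pose a (X : {set 'I_m.+1}) := #|[set f | P f && (f @: setT == wid @: X)]|.
pose b (X : {set 'I_m.+1}) :=
  #|[set g : {ffun 'I_m.+1 -> 'I_m.+1} | xpredT g && (g @: setT == X)]|.
have ab X : a X = b X.
  refine (@subset_sum_inj _ a b m.+1 _ X _); last first.
    by rewrite -[X in _ <= X](card_ord m.+1) max_card.
  move=> S _; rewrite {}/a {}/b.
  rewrite -(card_value_subset (fun g : {ffun 'I_m.+1 -> 'I_m.+1} => g @: setT)).
  transitivity (#|S| ^ m.+1); last first.
    have h0 : {in set0, forall x : 'I_m.+1, x \in S} by move=> x; rewrite inE.
    have := card_ffun_agree h0; rewrite cards0 card_ord subn0 => <-.
    apply: eq_card => g; rewrite !inE; congr (_ && _); apply/forall_inP.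
    by move=> x; rewrite inE.
  rewrite -(card_imset (mem S) wid_inj) -num_rec1 -[X in X * _]ffactn1.
  rewrite -card_connected_sub // mul1n card_value_subset.
  rewrite [RHS](reindex_onto (fun X : {set _} => wid @: X) (fun Y => wid @^-1: Y)) /=.
    apply: eq_bigl => Y.
    have -> : wid @^-1: (wid @: Y) = Y by apply/setP => i; rewrite inE mem_imset.
    rewrite eqxx andbT; apply/idP/idP => [|/subsetP sYS]; first exact: imsetS.
    by apply/subsetP => y Yy; rewrite -(mem_imset _ _ wid_inj) sYS ?imset_f.
  move=> Y sYS; apply/setP => y; apply/imsetP/idP => [[x]|Yy].
    by rewrite inE => Yx ->.
  by have /imsetP[x _ eqy] := subsetP sYS y Yy; exists x; rewrite // inE -eqy.
apply: eq_bigr => k _; rewrite -/(b _) -ab /a; apply: eq_card => f; rewrite !inE.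
congr (_ && (_ == _)); apply/setP => i; rewrite inE; apply/idP/imsetP.
  move=> lt_ik; have lt_im : i < m.+1 by apply: leq_trans lt_ik _; rewrite -ltnS.
  by exists (Ordinal lt_im); [rewrite inE | apply: val_inj].
by case=> j; rewrite inE => lt_jk ->.
Qed.

(** Treated apart because the preceding argument fails for empty S: there is one map from the empty
    set to S, but no tree on one point with image in S. *)
Lemma card_CayTree1 : #|CayTree 1| = #|Cay 0|.
Proof.
have -> : CayTree 1 = setT.
  apply/setP => f; rewrite !inE.
  have eq0 (u v : 'I_1) : u = v by rewrite (ord1 u) (ord1 v).
  apply/and3P; split.
  - apply/existsP; exists ord_max; apply/eqP/setP => i.
    by rewrite inE ltn_ord (eq0 i (f i)) imset_f.
  - by apply/forallP => u; apply/forallP => v; rewrite (eq0 u v) connect0.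
  apply/existsP; exists ord0; apply/andP; split; first exact/eqP.
  apply/forallP => v; rewrite (eq0 v ord0) eqxx eqb_id.
  by rewrite /recurrent (eq0 (f _) ord0) connect0.
have -> : Cay 0 = setT.
  apply/setP => f; rewrite !inE; apply/existsP; exists ord0.
  by apply/eqP/setP => -[].
by rewrite !cardsT !card_ffun !card_ord.
Qed.

(** * The three formulas *)

Local Open Scope ring_scope.

Theorem proposition5p7 :
  (forall n : nat, (1 <= n)%N -> #|CayTree n| = #|Cay (n - 1)|) /\
  (forall n : nat,
     #|CayForest n|%:R =
       \sum_(0 <= r < n.+1) (1 / r`!%:R) *
         \sum_(0 <= i < n.+1) i`!%:R * rStirling2_diff r n i :> rat) /\
  (forall n : nat,
     #|CayConnected n|%:R =
       \sum_(1 <= r < n.+1) (1 / r%:R) *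
         \sum_(0 <= i < n.+1) i`!%:R * rStirling2_diff r n i :> rat).
Proof.
split=> [[//|[|m]] _|].
- by rewrite card_CayTree1.
- by rewrite subn1 card_CayTree_add2.
have divK (a b : nat) (x : rat) : (0 < a)%N -> (a * b)%:R = x -> b%:R = 1 / a%:R * x.
  move=> a0 <-; rewrite GRing.natrM GRing.mulrA GRing.mul1r GRing.mulVf ?GRing.mul1r //.
  by rewrite Num.Theory.pnatr_eq0 -lt0n.
split=> n; rewrite /CayForest /CayConnected card_Cay_split_rec.
  rewrite GRing.natr_sum big_mkord; apply: eq_bigr => r _.
  apply: divK; first exact: fact_gt0.
  by apply: card_Cay_rec => [|S]; [rewrite -ltnS | apply: card_forest_sub].
(* The sum starts at r = 1: a connected digraph is nonempty, so it has a recurrent point. *)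
rewrite big_ord_recl /= [X in (X + _)%N](_ : _ = 0%N) ?add0n.
  rewrite GRing.natr_sum big_add1 big_mkord; apply: eq_bigr => r _.
  apply: divK => //; apply: card_Cay_rec => [|S]; first exact: ltn_ord.
  exact: card_connected_sub.
apply: eq_card0 => f; rewrite inE; apply/negP => /and3P[_].
rewrite connected_digraphE => /andP[n0 _]; rewrite cards_eq0 => /eqP rec0.
by have [v] := fconnect_rec f (Ordinal n0); rewrite rec0 inE.
Qed.
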